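(* If $n$ is a positive integer, then $$\left(\frac{n!}{\sqrt{\pi}\,(n/e)^n}\right)^6 - 8n^3-4n^2-n \;\geq\; \frac{1-\frac{3}{2n}}{30}.$$ *)

(* Defs.v *)
From Stdlib Require Export Reals Factorial.

(* Main.v *)
(** Write [rho n] for the quotient of [n!] by [sqrt PI * (n/e)^n], and [P n] for
    [8n^3 + 4n^2 + n + 1/30 - 1/(20n)], so that the claim reads [P n <= rho n ^ 6].
    The defect [d n = ln (P n) - 6 ln (rho n)] is nondecreasing, which comes down to
    a rational inequality once [ln (1 + 1/n)] and [ln (P (n+1) / P n)] are
    replaced by truncated [artanh] expansions.  It is bounded above, and Wallis'
    integrals give [2 d(n) <= d(2n) + 2/n].  If some [d n] were positive, repeated
    doubling would therefore make [d] unbounded. *)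
Require Import Defs.
From Stdlib Require Import Reals Factorial Lra Lia.
From Coquelicot Require Import Coquelicot.
Open Scope R_scope.

(** * Truncated expansions of [ln ((1 + t) / (1 - t))] *)

Lemma nonneg_of_derive (f df : R -> R) (x : R) :
  0 <= x < 1 -> f 0 = 0 ->
  (forall y, 0 <= y < 1 -> is_derive f y (df y)) ->
  (forall y, 0 <= y < 1 -> 0 <= df y) ->
  0 <= f x.
Proof.
intros Hx f0 Hf Hdf.
destruct (Req_dec x 0) as [-> | Hx0]; [lra|].
destruct (MVT_gen f 0 x df) as [c [Hc E]].
- intros y; rewrite Rmin_left, Rmax_right by lra; intros Hy; apply Hf; lra.
- intros y; rewrite Rmin_left, Rmax_right by lra; intros Hy.
  apply derivable_continuous_pt; exists (df y).
  apply is_derive_Reals, Hf; lra.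
- rewrite Rmin_left, Rmax_right in Hc by lra.
  assert (0 <= df c * (x - 0)) by (apply Rmult_le_pos; [apply Hdf|]; lra).
  lra.
Qed.

(** The difference of the two sides vanishes at 0, and its derivative is what remains of the
    geometric series of [2 / (1 - t ^ 2)] after three terms. *)
Lemma ln_artanh_ge (t : R) : 0 <= t < 1 ->
  2 * t + 2 / 3 * t ^ 3 + 2 / 5 * t ^ 5 <= ln ((1 + t) / (1 - t)).
Proof.
intros Ht.
rewrite ln_div by lra.
enough (0 <= ln (1 + t) - ln (1 - t) - (2 * t + 2 / 3 * t ^ 3 + 2 / 5 * t ^ 5)) by lra.
apply (nonneg_of_derive
  (fun t => ln (1 + t) - ln (1 - t) - (2 * t + 2 / 3 * t ^ 3 + 2 / 5 * t ^ 5))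
  (fun t => 2 * t ^ 6 / ((1 + t) * (1 - t)))); [exact Ht| | |].
- rewrite Rplus_0_r, Rminus_0_r, ln_1; ring.
- intros y Hy; auto_derive; [lra|]; field; lra.
- intros y Hy; apply Rmult_le_pos.
  + apply Rmult_le_pos; [lra | apply pow_le; lra].
  + apply Rlt_le, Rinv_0_lt_compat, Rmult_lt_0_compat; lra.
Qed.

(** All coefficients of the series from [t ^ 3] on are at most 2/3, so the tail is dominated by a
    geometric series of ratio [t ^ 2]. *)
Lemma ln_artanh_le (t : R) : 0 <= t < 1 ->
  ln ((1 + t) / (1 - t)) <= 2 * t + 2 / 3 * t ^ 3 / (1 - t ^ 2).
Proof.
intros Ht.
rewrite ln_div by lra.
enough (0 <= 2 * t + 2 / 3 * t ^ 3 / (1 - t ^ 2) - (ln (1 + t) - ln (1 - t))) by lra.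
apply (nonneg_of_derive
  (fun t => 2 * t + 2 / 3 * t ^ 3 / (1 - t ^ 2) - (ln (1 + t) - ln (1 - t)))
  (fun t => 4 / 3 * t ^ 4 / (1 - t ^ 2) ^ 2)); [exact Ht| | |].
- rewrite Rplus_0_r, Rminus_0_r, ln_1; field.
- intros y Hy.
  assert (0 < 1 - y ^ 2) by nra.
  auto_derive; [repeat split; nra|]; field; repeat split; nra.
- intros y Hy.
  assert (0 < 1 - y ^ 2) by nra.
  apply Rmult_le_pos.
  + apply Rmult_le_pos; [lra | apply pow_le; lra].
  + apply Rlt_le, Rinv_0_lt_compat, pow_lt; lra.
Qed.

(** * Wallis' integrals and the central binomial coefficient *)

Definition wallis (n : nat) : R := RInt (fun x => sin x ^ n) 0 (PI / 2).

Lemma continuous_sin_pow (n : nat) (x : R) : continuous (fun x => sin x ^ n) x.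
Proof.
apply (ex_derive_continuous (fun x => sin x ^ n)); auto_derive; exact I.
Qed.

Lemma ex_RInt_sin_pow (n : nat) (a b : R) : ex_RInt (fun x => sin x ^ n) a b.
Proof.
apply (ex_RInt_continuous (V := R_CompleteNormedModule)).
intros; apply continuous_sin_pow.
Qed.

Lemma wallis_0 : wallis 0 = PI / 2.
Proof.
unfold wallis; simpl; rewrite RInt_const; unfold scal; simpl; unfold mult; simpl; ring.
Qed.

Lemma wallis_1 : wallis 1 = 1.
Proof.
apply is_RInt_unique.
replace 1 with (- cos (PI / 2) - - cos 0) by (rewrite cos_0, cos_PI2; ring).
apply (is_RInt_derive (fun x => - cos x) (fun x => sin x ^ 1)).
- intros x _; auto_derive; [exact I | ring].
- intros x _; apply continuous_sin_pow.
Qed.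

(** Integrate the derivative of [sin x ^ (n + 1) * cos x], a function that vanishes at both
    endpoints. *)
Lemma wallis_rec (n : nat) : INR (n + 2) * wallis (n + 2) = INR (n + 1) * wallis n.
Proof.
assert (H : is_RInt (fun x => INR (n + 1) * sin x ^ n - INR (n + 2) * sin x ^ (n + 2))
              0 (PI / 2) (sin (PI / 2) ^ (n + 1) * cos (PI / 2) - sin 0 ^ (n + 1) * cos 0)).
{ apply (is_RInt_derive (fun x => sin x ^ (n + 1) * cos x)
           (fun x => INR (n + 1) * sin x ^ n - INR (n + 2) * sin x ^ (n + 2))).
  - intros x _; auto_derive; [exact I|].
    replace (Init.Nat.pred (n + 1)) with n by lia.
    rewrite !pow_add, !plus_INR; simpl.
    assert (Hc : cos x * cos x = 1 - sin x * sin x).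
    { generalize (sin2_cos2 x); unfold Rsqr; lra. }
    transitivity ((INR n + 1) * sin x ^ n * (cos x * cos x) - sin x ^ n * (sin x * sin x));
      [ring | rewrite Hc; ring].
  - intros x _.
    apply (ex_derive_continuous
      (fun x => INR (n + 1) * sin x ^ n - INR (n + 2) * sin x ^ (n + 2))).
    auto_derive; exact I. }
assert (H' : is_RInt (fun x => INR (n + 1) * sin x ^ n - INR (n + 2) * sin x ^ (n + 2))
              0 (PI / 2) (INR (n + 1) * wallis n - INR (n + 2) * wallis (n + 2))).
{ apply (is_RInt_minus (V := R_NormedModule));
    apply (is_RInt_scal (V := R_NormedModule));
    apply (RInt_correct (V := R_CompleteNormedModule)), ex_RInt_sin_pow. }
generalize (is_RInt_unique _ _ _ _ H); rewrite (is_RInt_unique _ _ _ _ H').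
rewrite cos_PI2, sin_0, pow_i by lia; lra.
Qed.

Lemma wallis_decr (n : nat) : wallis (S n) <= wallis n.
Proof.
generalize PI_RGT_0; intros Hpi.
apply RInt_le; [lra | apply ex_RInt_sin_pow | apply ex_RInt_sin_pow |].
intros x Hx; simpl.
assert (0 <= sin x) by (apply sin_ge_0; lra).
generalize (SIN_bound x) (pow_le (sin x) n); nra.
Qed.

(** By [wallis_rec] the product does not depend on [n]. *)
Lemma wallis_mul (n : nat) : INR (S n) * wallis (S n) * wallis n = PI / 2.
Proof.
induction n as [|n IH].
- rewrite wallis_0, wallis_1; simpl; ring.
- generalize (wallis_rec n).
  replace (n + 2)%nat with (S (S n)) by lia; replace (n + 1)%nat with (S n) by lia.
  intros ->; rewrite <- IH; ring.
Qed.

Lemma wallis_even (n : nat) :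
  wallis (2 * n) = PI / 2 * (INR (fact (2 * n)) / (4 ^ n * INR (fact n) ^ 2)).
Proof.
induction n as [|n IH].
- simpl (2 * 0)%nat; rewrite wallis_0; simpl; field.
- generalize (wallis_rec (2 * n)).
  replace (2 * S n)%nat with (S (S (2 * n))) by lia.
  replace (2 * n + 2)%nat with (S (S (2 * n))) by lia.
  replace (2 * n + 1)%nat with (S (2 * n)) by lia.
  rewrite IH, !fact_simpl, !mult_INR, !S_INR, !mult_INR.
  change (INR 2) with 2.
  generalize (pos_INR n) (INR_fact_neq_0 n) (pow_nonzero 4 n); intros Hn Hf H4.
  intros H.
  apply (Rmult_eq_reg_l (2 * INR n + 1 + 1)); [rewrite H; simpl; field | lra].
  repeat split; try lra; apply H4; lra.
Qed.

(** This bounds the central binomial coefficient by [4 ^ n / sqrt (PI * n)]. In [wallis_mul] at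
    [2 * n - 1], the factor [wallis (2 * n - 1)] is replaced by the smaller [wallis (2 * n)]. *)
Lemma fact_double_le (n : nat) : (0 < n)%nat ->
  PI * INR n * INR (fact (2 * n)) ^ 2 <= (4 ^ n * INR (fact n) ^ 2) ^ 2.
Proof.
intros hn.
assert (Hn : 0 < INR n) by (apply lt_0_INR; exact hn).
generalize PI_RGT_0 (INR_fact_lt_0 n) (INR_fact_lt_0 (2 * n)); intros Hpi Hf Hf2.
assert (Hb : 0 < 4 ^ n * INR (fact n) ^ 2).
{ apply Rmult_lt_0_compat; apply pow_lt; lra. }
assert (Hw : 2 * INR n * wallis (2 * n) ^ 2 <= PI / 2).
{ generalize (wallis_mul (2 * n - 1)) (wallis_decr (2 * n - 1)).
  replace (S (2 * n - 1)) with (2 * n)%nat by lia.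
  rewrite mult_INR; change (INR 2) with 2; intros <- Hd.
  assert (0 <= wallis (2 * n)).
  { rewrite wallis_even; apply Rlt_le, Rmult_lt_0_compat; [lra|].
    apply Rdiv_lt_0_compat; assumption. }
  replace (2 * INR n * wallis (2 * n) ^ 2)
    with (2 * INR n * wallis (2 * n) * wallis (2 * n)) by ring.
  apply Rmult_le_compat_l; [|exact Hd].
  apply Rmult_le_pos; lra. }
rewrite wallis_even in Hw.
set (b := 4 ^ n * INR (fact n) ^ 2) in *.
set (f := INR (fact (2 * n))) in *.
apply (Rmult_le_compat_r (2 / PI * b ^ 2)) in Hw.
- replace (2 * INR n * (PI / 2 * (f / b)) ^ 2 * (2 / PI * b ^ 2))
    with (PI * INR n * f ^ 2) in Hw by (field; lra).
  replace (PI / 2 * (2 / PI * b ^ 2)) with (b ^ 2) in Hw by (field; lra).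
  exact Hw.
- apply Rmult_le_pos; [apply Rlt_le, Rdiv_lt_0_compat; lra | apply pow_le; lra].
Qed.

(** * The Stirling quotient under successor and doubling *)

Definition rho (n : nat) : R := INR (fact n) / (sqrt PI * (INR n / exp 1) ^ n).

Lemma stirling_pos (n : nat) : (0 < n)%nat -> 0 < sqrt PI * (INR n / exp 1) ^ n.
Proof.
intros hn; apply Rmult_lt_0_compat.
- apply sqrt_lt_R0, PI_RGT_0.
- apply pow_lt, Rdiv_lt_0_compat; [apply lt_0_INR, hn | apply exp_pos].
Qed.

Lemma rho_pos (n : nat) : (0 < n)%nat -> 0 < rho n.
Proof.
intros hn; apply Rdiv_lt_0_compat; [apply INR_fact_lt_0 | apply stirling_pos, hn].
Qed.

Lemma ln_rho (n : nat) : (0 < n)%nat ->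
  ln (rho n) = ln (INR (fact n)) - ln PI / 2 - INR n * (ln (INR n) - 1).
Proof.
intros hn.
assert (Hn : 0 < INR n) by (apply lt_0_INR; exact hn).
generalize PI_RGT_0 (exp_pos 1); intros Hpi He.
assert (Hs : 0 < sqrt PI) by (apply sqrt_lt_R0; exact Hpi).
assert (Hq : 0 < INR n / exp 1) by (apply Rdiv_lt_0_compat; assumption).
assert (E : ln PI = 2 * ln (sqrt PI)).
{ rewrite <- (sqrt_sqrt PI) at 1 by lra; rewrite ln_mult by assumption; ring. }
unfold rho; rewrite ln_div by (apply INR_fact_lt_0 || apply stirling_pos, hn).
rewrite ln_mult by (try apply pow_lt; assumption).
rewrite ln_pow, ln_div, ln_exp, E by assumption; field.
Qed.

Lemma ln_rho_S (n : nat) : (0 < n)%nat ->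
  ln (rho (S n)) = ln (rho n) + 1 - INR n * (ln (INR n + 1) - ln (INR n)).
Proof.
intros hn.
assert (Hn : 0 < INR n) by (apply lt_0_INR; exact hn).
rewrite !ln_rho, fact_simpl, mult_INR by lia.
rewrite ln_mult by (apply INR_fact_lt_0 || (apply lt_0_INR; lia)).
rewrite S_INR; ring.
Qed.

(** The logarithm of [fact_double_le]; the terms in [INR n * ln (INR n)] cancel. *)
Lemma ln_rho_double (n : nat) : (0 < n)%nat ->
  ln (INR n) / 2 + ln (rho (2 * n)) <= 2 * ln (rho n).
Proof.
intros hn.
assert (Hn : 0 < INR n) by (apply lt_0_INR; exact hn).
generalize PI_RGT_0 (INR_fact_lt_0 n) (INR_fact_lt_0 (2 * n)); intros Hpi Hf Hf2.
generalize (fact_double_le n hn); intros H.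
assert (Hpn : 0 < PI * INR n) by (apply Rmult_lt_0_compat; assumption).
assert (H4 : 0 < 4 ^ n) by (apply pow_lt; lra).
assert (Hff : 0 < INR (fact n) ^ 2) by (apply pow_lt; exact Hf).
apply ln_le in H; [|apply Rmult_lt_0_compat; [exact Hpn | apply pow_lt; exact Hf2]].
rewrite ln_mult in H by (try apply pow_lt; assumption).
rewrite (ln_mult PI) in H by assumption.
rewrite !ln_pow in H by (try apply Rmult_lt_0_compat; assumption).
rewrite ln_mult, !ln_pow in H by (assumption || lra).
replace 4 with (2 * 2) in H by ring.
rewrite (ln_mult 2 2) in H by lra.
rewrite !ln_rho, mult_INR by lia.
change (INR 2) with 2 in *; rewrite (ln_mult 2) by lra.
lra.
Qed.

(** * Bounds on [ln (x + 1) - ln x] and the growth of [rho] *)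

Lemma ln_succ_ratio_ge (x : R) : 0 < x ->
  2 / (2 * x + 1) + 2 / 3 / (2 * x + 1) ^ 3 + 2 / 5 / (2 * x + 1) ^ 5
    <= ln (x + 1) - ln x.
Proof.
intros Hx.
(* With [t = 1 / (2 * x + 1)] one has [(1 + t) / (1 - t) = (x + 1) / x]. *)
assert (Ht : 0 <= 1 / (2 * x + 1) < 1).
{ split; [apply Rlt_le, Rdiv_lt_0_compat; lra|].
  apply Rlt_div_l; lra. }
generalize (ln_artanh_ge (1 / (2 * x + 1)) Ht).
replace ((1 + 1 / (2 * x + 1)) / (1 - 1 / (2 * x + 1))) with ((x + 1) / x) by (field; lra).
rewrite ln_div by lra.
intros H; eapply Rle_trans; [|exact H]; right; field; lra.
Qed.

(** The expansion gives [1 + 1 / (12 * x * (x + 1))]; the 12 is weakened to 4, and the bound is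
    written so as to telescope. *)
Lemma ln_succ_ratio_le (x : R) : 0 < x ->
  (x + / 2) * (ln (x + 1) - ln x) <= 1 + (/ (4 * x) - / (4 * (x + 1))).
Proof.
intros Hx.
assert (Ht : 0 <= 1 / (2 * x + 1) < 1).
{ split; [apply Rlt_le, Rdiv_lt_0_compat; lra|].
  apply Rlt_div_l; lra. }
generalize (ln_artanh_le (1 / (2 * x + 1)) Ht).
replace ((1 + 1 / (2 * x + 1)) / (1 - 1 / (2 * x + 1))) with ((x + 1) / x) by (field; lra).
rewrite ln_div by lra.
intros H; apply (Rmult_le_compat_l (x + / 2)) in H; [|lra].
eapply Rle_trans; [exact H|].
assert (E : 1 + (/ (4 * x) - / (4 * (x + 1)))
  - (x + / 2) * (2 * (1 / (2 * x + 1))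
      + 2 / 3 * (1 / (2 * x + 1)) ^ 3 / (1 - (1 / (2 * x + 1)) ^ 2))
  = / (6 * x * (x + 1))).
{ field; repeat split; nra. }
assert (0 < / (6 * x * (x + 1))) by (apply Rinv_0_lt_compat; nra).
lra.
Qed.

Lemma ln_rho_lower (n : nat) : (0 < n)%nat ->
  ln (rho 1) - / 4 <= ln (rho n) - ln (INR n) / 2.
Proof.
intros hn.
(* The strengthened right-hand side is nondecreasing in [n], with equality at [n = 1]. *)
enough (ln (rho 1) - / 4 <= ln (rho n) - ln (INR n) / 2 - / (4 * INR n)).
{ assert (0 < / (4 * INR n)).
  { apply Rinv_0_lt_compat; apply lt_0_INR in hn; lra. }
  lra. }
induction n as [|n IH]; [lia|].
destruct n as [|n].
- change (INR 1) with 1; rewrite ln_1; lra.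
- assert (Hn : 0 < INR (S n)) by (apply lt_0_INR; lia).
  specialize (IH ltac:(lia)).
  generalize (ln_succ_ratio_le _ Hn).
  rewrite (ln_rho_S (S n)), (S_INR (S n)) by lia; lra.
Qed.

(** * Size and successive ratios of [P] *)

Definition P (x : R) : R := 8 * x ^ 3 + 4 * x ^ 2 + x + / 30 - / (20 * x).

Lemma P_ge (x : R) : 1 <= x -> 8 * x ^ 3 <= P x.
Proof.
intros Hx; unfold P.
assert (/ (20 * x) <= / 20) by (apply Rinv_le_contravar; lra).
nra.
Qed.

Lemma P_pos (x : R) : 1 <= x -> 0 < P x.
Proof.
intros Hx; generalize (P_ge x Hx) (pow_lt x 3); lra.
Qed.

Lemma ln_P_ge (x : R) : 1 <= x -> ln 8 + 3 * ln x <= ln (P x).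
Proof.
intros Hx.
assert (0 < x ^ 3) by (apply pow_lt; lra).
replace (3 * ln x) with (ln (x ^ 3)) by (rewrite ln_pow by lra; simpl; ring).
rewrite <- ln_mult by lra.
apply ln_le; [lra | apply P_ge, Hx].
Qed.

Lemma ln_P_le (x : R) : 1 <= x -> ln (P x) <= ln 8 + 3 * ln x + / x.
Proof.
intros Hx.
assert (Hx3 : 0 < x ^ 3) by (apply pow_lt; lra).
assert (0 < / x) by (apply Rinv_0_lt_compat; lra).
replace (3 * ln x) with (ln (x ^ 3)) by (rewrite ln_pow by lra; simpl; ring).
rewrite <- (ln_exp (/ x)), <- !ln_mult by (try apply exp_pos; lra).
apply ln_le; [apply P_pos, Hx|].
apply Rle_trans with (8 * x ^ 3 * (1 + / x)).
- replace (8 * x ^ 3 * (1 + / x)) with (8 * x ^ 3 + 8 * x ^ 2) by (field; lra).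
  unfold P.
  assert (0 < / (20 * x)) by (apply Rinv_0_lt_compat; lra).
  nra.
- apply Rmult_le_compat_l; [lra|].
  apply exp_ineq1_le.
Qed.

(** Expanding [ln (P (x + 1) / P x)] directly is too inaccurate near [x = 1]:
    the factor [((x + 1) / x) ^ 3] is split off first, leaving a quotient [v / u]
    close to 1. *)
Lemma ln_P_ratio (x : R) : 1 <= x ->
  6 - 6 * x * (ln (x + 1) - ln x) <= ln (P (x + 1)) - ln (P x).
Proof.
intros Hx.
(* [p x] is [60 * x * P x]. The fourth powers in [u] and [v] combine the cube split off with this
   extra factor [x]. *)
set (p := fun x => 480 * x ^ 4 + 240 * x ^ 3 + 60 * x ^ 2 + 2 * x - 3).
set (u := p x * (x + 1) ^ 4); set (v := p (x + 1) * x ^ 4).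
assert (HP : forall y, 1 <= y -> P y = p y / (60 * y)).
{ intros y Hy; unfold P, p; field; lra. }
assert (Hp : forall y, 1 <= y -> 0 < p y).
{ intros y Hy; unfold p.
  generalize (pow_R1_Rle y 4 Hy) (pow_R1_Rle y 3 Hy) (pow_R1_Rle y 2 Hy); lra. }
assert (Hpx : 0 < p x) by (apply Hp; lra).
assert (Hpx1 : 0 < p (x + 1)) by (apply Hp; lra).
assert (Hu : 0 < u) by (apply Rmult_lt_0_compat; [|apply pow_lt]; lra).
assert (Hv : 0 < v) by (apply Rmult_lt_0_compat; [|apply pow_lt]; lra).
assert (Huv : v <= u).
(* In the variable [m = x - 1], the polynomial [u - v] has no negative coefficient. *)
{ unfold u, v, p; replace x with (x - 1 + 1) by ring.
  assert (Hm : 0 <= x - 1) by lra; generalize (x - 1) Hm; intros m Hm'.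
  apply Rminus_le_0; ring_simplify.
  repeat apply Rplus_le_le_0_compat; try lra;
    apply Rmult_le_pos; try lra; apply pow_le, Hm'. }
assert (Hw : 0 <= (u - v) / (u + v) < 1).
{ split; [apply Rdiv_le_0_compat; lra | apply Rlt_div_l; lra]. }
generalize (ln_artanh_le _ Hw).
replace ((1 + (u - v) / (u + v)) / (1 - (u - v) / (u + v))) with (u / v) by (field; lra).
intros Huv'.
assert (E : ln (P (x + 1)) - ln (P x) = 3 * (ln (x + 1) - ln x) - ln (u / v)).
{ unfold u, v; rewrite !HP by lra.
  assert (0 < x ^ 4) by (apply pow_lt; lra).
  assert (0 < (x + 1) ^ 4) by (apply pow_lt; lra).
  rewrite !ln_div by (try apply Rmult_lt_0_compat; lra).
  rewrite (ln_mult (p x)), (ln_mult (p (x + 1))), !ln_mult, !ln_pow by lra.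
  simpl; ring. }
rewrite E.
generalize (ln_succ_ratio_ge x ltac:(lra)); intros Hl.
(* The goal contributes [6 * x] and the split-off cube 3 to the coefficient of
   [ln (x + 1) - ln x]. *)
apply (Rmult_le_compat_l (6 * x + 3)) in Hl; [|lra].
enough (0 <= (6 * x + 3)
    * (2 / (2 * x + 1) + 2 / 3 / (2 * x + 1) ^ 3 + 2 / 5 / (2 * x + 1) ^ 5)
  - (2 * ((u - v) / (u + v))
      + 2 / 3 * ((u - v) / (u + v)) ^ 3 / (1 - ((u - v) / (u + v)) ^ 2)) - 6) by lra.
assert (Ht : 0 < 2 * x + 1) by lra.
(* As [6 * x + 3] is three times [2 * x + 1], the leading term cancels the 6. With
   [w = (u - v) / (u + v)], [1 - w ^ 2] is [4 * u * v / (u + v) ^ 2]. *)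
match goal with |- 0 <= ?d =>
  replace d with
  (((2 * (2 * x + 1) ^ 2 + 6 / 5) * (6 * (u + v) * u * v)
     - (2 * x + 1) ^ 4 * (12 * (u - v) * u * v + (u - v) ^ 3))
   / ((2 * x + 1) ^ 4 * (6 * (u + v) * u * v)))
end.
2: { field; repeat split; try lra; nra. }
apply Rdiv_le_0_compat.
2: { repeat apply Rmult_lt_0_compat; try apply pow_lt; lra. }
unfold u, v, p; replace x with (x - 1 + 1) by ring.
assert (Hm : 0 <= x - 1) by lra; generalize (x - 1) Hm; intros m Hm'.
(* As a polynomial in [m = x - 1], this numerator has only positive coefficients. *)
match goal with |- 0 <= ?e => replace e with (/ 5 * (5 * e)) by field end.
apply Rmult_le_pos; [lra|].
field_simplify.
repeat apply Rplus_le_le_0_compat; try lra;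
  apply Rmult_le_pos; try lra; apply pow_le, Hm'.
Qed.

(** * The defect: monotonicity, boundedness and doubling *)

Definition defect (n : nat) : R := ln (P (INR n)) - 6 * ln (rho n).

Lemma INR_ge_1 (n : nat) : (0 < n)%nat -> 1 <= INR n.
Proof. intros hn; apply (le_INR 1); lia. Qed.

Lemma defect_le (m n : nat) : (0 < m <= n)%nat -> defect m <= defect n.
Proof.
intros [hm hmn]; induction hmn as [|n hmn IH]; [lra|].
apply (Rle_trans _ _ _ IH).
generalize (ln_P_ratio (INR n) (INR_ge_1 n ltac:(lia))).
unfold defect; rewrite ln_rho_S, S_INR by lia; lra.
Qed.

Lemma defect_bounded (n : nat) : (0 < n)%nat ->
  defect n <= ln 8 + 1 - 6 * (ln (rho 1) - / 4).
Proof.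
intros hn.
generalize (INR_ge_1 n hn); intros Hn.
generalize (ln_P_le _ Hn) (ln_rho_lower n hn); unfold defect.
assert (/ INR n <= 1) by (rewrite <- Rinv_1; apply Rinv_le_contravar; lra).
lra.
Qed.

(** Since [ln 8 = 3 * ln 2], the leading terms of [ln (P x)] match [ln_rho_double] exactly; the
    error is twice the [/ x] of [ln_P_le]. *)
Lemma defect_double (n : nat) : (0 < n)%nat ->
  2 * defect n <= defect (2 * n) + 2 / INR n.
Proof.
intros hn.
generalize (INR_ge_1 n hn); intros Hn.
generalize (ln_P_le _ Hn) (ln_P_ge (2 * INR n) ltac:(lra)) (ln_rho_double n hn).
unfold defect; rewrite mult_INR; change (INR 2) with 2.
rewrite (ln_mult 2) by lra.
replace (ln 8) with (3 * ln 2)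
  by (replace 8 with (2 ^ 3) by ring; rewrite ln_pow by lra; simpl; ring).
unfold Rdiv; lra.
Qed.

Lemma defect_nonpos (n : nat) : (0 < n)%nat -> defect n <= 0.
Proof.
intros hn; apply Rnot_lt_le; intros Hd.
destruct (nfloor_ex (4 / defect n)) as [N0 [_ HN0]].
{ apply Rlt_le, Rdiv_lt_0_compat; lra. }
(* [N] is at least [n], for monotonicity, and exceeds [4 / defect n], so that the doubling error
   stays below [defect n / 2]. *)
set (N := (n + S N0)%nat).
assert (HN : 4 / defect n < INR N).
{ unfold N; rewrite plus_INR, S_INR; generalize (pos_INR n); lra. }
(* Each doubling adds the current defect, at least [defect n], and loses at most half of
   [defect n]. *)
assert (Hgrow : forall k, defect N + INR k * (defect n / 2) <= defect (2 ^ k * N)).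
{ induction k as [|k IH]; [simpl; rewrite Nat.add_0_r; lra|].
  assert (Hle : (N <= 2 ^ k * N)%nat).
  { generalize (Nat.pow_nonzero 2 k); nia. }
  assert (Hpos : (0 < 2 ^ k * N)%nat) by (unfold N in *; lia).
  generalize (defect_double _ Hpos) (defect_le n (2 ^ k * N) ltac:(unfold N in *; lia)).
  replace (2 * (2 ^ k * N))%nat with (2 ^ S k * N)%nat by (simpl; lia).
  assert (HM : 4 / defect n < INR (2 ^ k * N)) by (apply le_INR in Hle; lra).
  assert (H2 : 2 / INR (2 ^ k * N) <= defect n / 2).
  { assert (0 < INR (2 ^ k * N)) by (apply lt_0_INR; exact Hpos).
    apply Rle_div_l; [lra|].
    apply Rlt_div_l in HM; lra. }
  rewrite S_INR; lra. }
set (C := ln 8 + 1 - 6 * (ln (rho 1) - / 4)).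
destruct (INR_unbounded ((C - defect N) / (defect n / 2))) as [k Hk].
apply Rlt_div_l in Hk; [|lra].
assert (Hb : defect (2 ^ k * N) <= C).
{ apply defect_bounded; generalize (Nat.pow_nonzero 2 k); unfold N; nia. }
specialize (Hgrow k); lra.
Qed.

Theorem proposition5 (n : nat) (hn : (0 < n)%nat) :
  (INR (fact n) / (sqrt PI * (INR n / exp 1) ^ n)) ^ 6
    - 8 * INR n ^ 3 - 4 * INR n ^ 2 - INR n
  >= (1 - 3 / (2 * INR n)) / 30.
Proof.
generalize (INR_ge_1 n hn); intros Hn.
fold (rho n).
assert (H : P (INR n) <= rho n ^ 6).
{ apply Rnot_lt_le; intros Hlt.
  apply ln_increasing in Hlt; [|apply pow_lt, rho_pos, hn].
  rewrite ln_pow in Hlt by (apply rho_pos, hn).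
  generalize (defect_nonpos n hn); unfold defect; simpl in Hlt; lra. }
replace ((1 - 3 / (2 * INR n)) / 30) with (/ 30 - / (20 * INR n)) by (field; lra).
unfold P in H; lra.
Qed.
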